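(* Consider the semi-discrete problem $\mathsf{M}(u_h)\,\mathrm{d}_t u_h+\mathsf{K}(u_h)u_h=g$ in $V_h'$, i.e. $\sum_{j\in\mathcal N_h(\Omega_i)}\mathsf M_{ij}(u_h)\,\mathrm d_t u_j+\sum_{j\in\mathcal N_h(\Omega_i)}\mathsf K_{ij}(u_h)u_j=g_i$ for every $i\in\mathcal N_h$. For a node $i$, consider the conditions $$\mathsf M_{ij}(u_h)=\delta_{ij}m_i \text{ with } m_i>0,\qquad \mathsf K_{ij}(u_h)\le 0\ \ \forall j\ne i,\qquad \sum_{j\in\mathcal N_h(\Omega_i)}\mathsf K_{ij}(u_h)=0 .\qquad(\ast)$$ (1) If $g=0$ in $\Omega$ and $(\ast)$ holds for every node $i\in\mathcal N_h$ such that $u_i$ is a local extremum, the problem is local extremum diminishing (LED): $\mathrm d_t u_i\le 0$ if $u_i$ is a maximum, and $\mathrm d_t u_i\ge 0$ if $u_i$ is a minimum. (2) If $g(\boldsymbol x)\le 0$ (resp. $g(\boldsymbol x)\ge 0$) in $\Omega$ and $(\ast)$ holds for all $i\in\mathcal N_h$ such that $u_i$ is a local maximum (resp. minimum), then the maximum is diminishing, $\mathrm d_t u_i\le 0$ (resp. the minimum is increasing, $\mathrm d_t u_i\ge 0$). (3) These results are also true for the discrete problem $\mathsf M(u_h^{n+1})\delta_t u_h^{n+1}+\mathsf K(u_h^{n+1})u_h^{n+1}=g^{n+1}$ in $V_h'$, with $\mathrm d_t$ replaced by $\delta_t$ and $(\ast)$ taken at $u_h^{n+1}$. (4) Furthermore,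 the discrete problem (with $(\ast)$ holding at every local extremum) is positivity-preserving for $g=0$ and $u_0\ge 0$, where $u_0$ is the initial datum of the continuous problem: the discrete solution satisfies $u_h^n\ge 0$ at all time steps.
   Context: $\Omega\subset\mathbb R^d$ is a bounded domain and $\mathcal T_h$ a conforming mesh of $\Omega$ (triangles/quadrilaterals for $d=2$, tetrahedra/hexahedra for $d=3$) with set of nodes $\mathcal N_h$; node $i$ has position $\boldsymbol x_i$. $\Omega_i$ is the union of the elements having $i$ as a node, and $\mathcal N_h(\Omega_i)$ is the set of nodes in $\Omega_i$ (including $i$). $V_h$ is the continuous piecewise linear ($P_1$; or multilinear $Q_1$ on quadrilaterals/hexahedra) finite element space with dual $V_h'$ and nodal basis $\{\varphi_i\}_{i\in\mathcal N_h}$, and $u_h=\sum_i u_i\varphi_i$. $\mathsf M(w_h)$ and $\mathsf K(w_h)$ are solution-dependent (nonlinear) operators (a mass operator, and the sum of a convection and a stabilization operator), with matrix entries $\mathsf M_{ij}(w_h)=\langle\mathsf M(w_h)\varphi_j,\varphi_i\rangle$ and $\mathsf K_{ij}(w_h)=\langle\mathsf K(w_h)\varphi_j,\varphi_i\rangle$ that vanish for $j\notin\mathcal N_h(\Omega_i)$. The right-hand side is $g_i=(g,\varphi_i)$, where $(\cdot,\cdot)$ is the $L^2(\Omega)$ inner product. $u_i$ is a local maximum (minimum) if $u_i\ge u_j$ ($u_i\le u_j$) for all $j\in\mathcal N_h(\Omega_i)$; a local extremum is a local maximum or minimum. Time is discretized by backward Euler on $0=t^0<t^1<\dots<t^N=T$: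 $\delta_t u_h^{n+1}=(u_h^{n+1}-u_h^n)/\Delta t_{n+1}$, $\Delta t_{n+1}=t^{n+1}-t^n$, with $u_h^0=\pi_h(u_0)\in V_h$, where $u_0\in L^\infty(\Omega)$ is the initial datum of the continuous problem and $\pi_h$ denotes a finite element interpolation, e.g. the Scott–Zhang projector.
   Formalization: Part (4) additionally assumes that the interpolation keeps the sign of the given initial datum, i.e. u_0 ≥ 0 implies π_h(u_0) ≥ 0 in Ω; without this it fails, e.g. for the Scott–Zhang projector with K = 0 and M lumped. *)

(* Defs.v *)
From HB Require Import structures.
From mathcomp Require Import all_boot all_order all_algebra.
From mathcomp Require Import all_classical all_reals all_analysis.
Set Implicit Arguments. Unset Strict Implicit. Unset Printing Implicit Defensive.
Import Order.TTheory GRing.Theory Num.Theory.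
Import numFieldNormedType.Exports.
Local Open Scope classical_set_scope.
Local Open Scope ring_scope.

(* R^n carries its Borel sigma-algebra, generated by the coordinates, and
   Lebesgue measure, the n-fold product of the one-dimensional one. *)
Section rV_measurable.
Context (R : realType) (n : nat).

Let coord (i : 'I_n) (x : 'rV[R]_n) : measurableTypeR R := x ord0 i.

Let set0m : g_sigma_preimage coord set0.
Proof. exact: sigma_algebra0. Qed.

Let setCm A : g_sigma_preimage coord A -> g_sigma_preimage coord (~` A).
Proof. exact: sigma_algebraC. Qed.

Let bigcupm (F : _^nat) : (forall i, g_sigma_preimage coord (F i)) ->
  g_sigma_preimage coord (\bigcup_i (F i)).
Proof. exact: sigma_algebra_bigcup. Qed.

HB.instance Definition _ := @isMeasurable.Build default_measure_display
  'rV[R]_n (g_sigma_preimage coord) set0m setCm bigcupm.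

End rV_measurable.

Section lebesgue_tuple.
Context (R : realType).
Local Notation RR := (measurableTypeR R).

Section step.
Context n (mu : {sigma_finite_measure set (n.-tuple RR) -> \bar R}).

Definition tcons (p : RR * n.-tuple RR) : n.+1.-tuple RR :=
  [tuple of p.1 :: p.2].

Let measurable_tcons : measurable_fun [set: RR * n.-tuple RR] tcons.
Proof. exact: measurable_cons. Qed.

HB.instance Definition _ := @isMeasurableFun.Build _ _ _ _ tcons measurable_tcons.

Definition lebesgue_cons : set (n.+1.-tuple RR) -> \bar R :=
  pushforward (lebesgue_measure \x mu)%E tcons.

Let lebesgue_cons0 : lebesgue_cons set0 = 0%E.
Proof. by rewrite /lebesgue_cons /pushforward preimage_set0 measure0. Qed.

Let lebesgue_cons_ge0 A : (0 <= lebesgue_cons A)%E.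
Proof. exact: measure_ge0. Qed.

Let lebesgue_cons_sigma_additive : semi_sigma_additive lebesgue_cons.
Proof. exact: (@measure_semi_sigma_additive _ _ _ (pushforward _ tcons)). Qed.

HB.instance Definition _ := isMeasure.Build _ _ _ lebesgue_cons
  lebesgue_cons0 lebesgue_cons_ge0 lebesgue_cons_sigma_additive.

Let lebesgue_cons_sigma_finite : sigma_finite setT lebesgue_cons.
Proof.
have /sigma_finiteP[F [TF ndF Foo]] := sigma_finiteT (@lebesgue_measure R).
have /sigma_finiteP[G [TG ndG Goo]] := sigma_finiteT mu.
pose uncons (t : n.+1.-tuple RR) : RR * n.-tuple RR :=
  (tnth t ord0, [tuple of behead t]).
have unconsK : cancel tcons uncons.
  by case=> x t; congr (_, _); apply/val_inj.
have muncons : measurable_fun setT uncons.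
  apply/measurable_fun_pairP; split; first exact: measurable_tnth.
  exact: measurable_behead.
exists (fun k => uncons @^-1` (F k `*` G k)) => [|k].
  rewrite -preimage_bigcup (_ : \bigcup_i _ = setT) ?preimage_setT//.
  apply/seteqP; split => // -[x y] _.
  have [m _ Fmx] : (\bigcup_i F i) x by rewrite -TF.
  have [p _ Gpy] : (\bigcup_i G i) y by rewrite -TG.
  exists (maxn m p) => //; split.
  - by move: x Fmx; exact/subsetPset/ndF/leq_maxl.
  - by move: y Gpy; exact/subsetPset/ndG/leq_maxr.
have [mFk Fkoo] := Foo k; have [mGk Gkoo] := Goo k.
split.
  by rewrite -[X in measurable X]setTI; apply: muncons => //; exact: measurableX.
rewrite /lebesgue_cons /pushforward -comp_preimage.
rewrite (_ : uncons \o _ = id) ?preimage_id; last exact/funext.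
by rewrite product_measure1E// lte_mul_pinfty// ge0_fin_numE.
Qed.

HB.instance Definition _ := Measure_isSigmaFinite.Build _ _ _ lebesgue_cons
  lebesgue_cons_sigma_finite.

End step.

Fixpoint lebesgue_tuple n : {sigma_finite_measure set (n.-tuple RR) -> \bar R} :=
  if n is n'.+1 then lebesgue_cons (lebesgue_tuple n')
  else \d_([tuple] : 0.-tuple RR).

Definition row_of_tuple n (t : n.-tuple RR) : 'rV[R]_n := \row_i tnth t i.

Let measurable_row_of_tuple n : measurable_fun setT (@row_of_tuple n).
Proof.
pose coord i (x : 'rV[R]_n) : RR := x ord0 i.
move=> _ A mA; rewrite setTI.
have coordE : (fun i => coord i \o @row_of_tuple n) = (fun i => @tnth n RR ^~ i).
  by apply/funext => i; apply/funext => t; rewrite /coord /= mxE.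
change (g_sigma_preimage (fun i => @tnth n RR ^~ i) (@row_of_tuple n @^-1` A)).
rewrite -coordE g_sigma_preimage_comp.
by exists A => //; rewrite setTI.
Qed.

HB.instance Definition _ n := @isMeasurableFun.Build _ _ _ _ (@row_of_tuple n)
  (@measurable_row_of_tuple n).

Definition lebesgue_rV n : set 'rV[R]_n -> \bar R :=
  pushforward (lebesgue_tuple n) (@row_of_tuple n).

Section lebesgue_rV_measure.
Context (n : nat).

Let lebesgue_rV0 : @lebesgue_rV n set0 = 0%E.
Proof. by rewrite /lebesgue_rV /pushforward preimage_set0 measure0. Qed.

Let lebesgue_rV_ge0 A : (0 <= @lebesgue_rV n A)%E.
Proof. exact: measure_ge0. Qed.

Let lebesgue_rV_sigma_additive : semi_sigma_additive (@lebesgue_rV n).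
Proof. exact: (@measure_semi_sigma_additive _ _ _ (pushforward _ (@row_of_tuple n))). Qed.

HB.instance Definition _ := isMeasure.Build _ _ _ (@lebesgue_rV n)
  lebesgue_rV0 lebesgue_rV_ge0 lebesgue_rV_sigma_additive.
End lebesgue_rV_measure.
End lebesgue_tuple.

(* Elements are images of a reference cell: the unit simplex (triangles,
   tetrahedra) or the unit cube (quadrilaterals, hexahedra). *)
Variant cell_shape := Simplex | Cube.

Definition vertex (d : nat) (s : cell_shape) : finType :=
  match s with Simplex => 'I_d.+1 | Cube => {ffun 'I_d -> bool} end.

Section reference_cell.
Context (R : realType) (d : nat).

Definition ref_cell (s : cell_shape) : set 'rV[R]_d :=
  match s with
  | Simplex => [set x | (forall i, 0 <= x ord0 i) /\ \sum_i x ord0 i <= 1]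
  | Cube => [set x | forall i, 0 <= x ord0 i <= 1]
  end.

(* The P1 (barycentric) and Q1 (multilinear) Lagrange shape functions.  Vertex
   0 of the simplex is the origin and vertex i+1 is the i-th unit vector; vertex
   b of the cube is the point whose i-th coordinate is 1 iff b i = true. *)
Definition shape_fun (s : cell_shape) : vertex d s -> 'rV[R]_d -> R :=
  match s return vertex d s -> 'rV[R]_d -> R with
  | Simplex => fun a x =>
      if unlift ord0 a is Some i then x ord0 i else 1 - \sum_i x ord0 i
  | Cube => fun b x =>
      \prod_(i < d) (if (b : {ffun 'I_d -> bool}) i then x ord0 i else 1 - x ord0 i)
  end.

Definition is_face (s : cell_shape) : {set vertex d s} -> Prop :=
  match s return {set vertex d s} -> Prop with
  | Simplex => fun _ => True
  | Cube => fun A => A = finset.set0 \/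
      exists (I : {set 'I_d}) (b : {ffun 'I_d -> bool}),
        A = [set a : {ffun 'I_d -> bool} | [forall i in I, a i == b i]]%SET
  end.

(* The face spanned by the vertices in A is the locus where the shape functions
   of all other vertices vanish. *)
Definition ref_face (s : cell_shape) (A : {set vertex d s}) : set 'rV[R]_d :=
  ref_cell s `&` [set x | forall a, a \notin A -> shape_fun a x = 0].

End reference_cell.

Definition domain (R : realType) (d : nat) (Om : set 'rV[R]_d) : Prop :=
  [/\ open Om, connected Om, Om !=set0 & bounded_set Om].

Record mesh (R : realType) (d : nat) := Mesh {
  node : finType;
  elem : finType;
  pos : node -> 'rV[R]_d;
  kind : elem -> cell_shape;
  vert : forall e : elem, vertex d (kind e) -> node }.
Arguments vert {R d m} e a.

Section mesh_geometry.
Context (R : realType) (d : nat) (T : mesh R d).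

(* (Multi)linear map from the reference cell onto the element e. *)
Definition elem_map (e : elem T) (x : 'rV[R]_d) : 'rV[R]_d :=
  \sum_a shape_fun a x *: pos (vert e a).

Definition cell (e : elem T) : set 'rV[R]_d :=
  elem_map e @` ref_cell (kind e).

Definition is_node_of (i : node T) (e : elem T) : Prop :=
  exists a, vert e a = i.

Definition common_vertices (e e' : elem T) : {set vertex d (kind e)} :=
  [set a | `[< is_node_of (vert e a) e' >]]%SET.

(* Injectivity of the element maps excludes degenerate elements.  Two distinct
   elements meet exactly in the (possibly empty) common proper face spanned by
   their common vertices. *)
Definition conforming (Om : set 'rV[R]_d) : Prop :=
  [/\ injective (@pos R d T),
      forall i : node T, exists e, is_node_of i e,
      forall e, {in ref_cell (kind e) &, injective (elem_map e)},
      closure Om = \bigcup_e cell e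
    & forall e e', e != e' ->
      [/\ is_face (common_vertices e e'), common_vertices e e' != finset.setT
        & cell e `&` cell e' =
          elem_map e @` ref_face (common_vertices e e')] ].

Definition patch (i : node T) : set 'rV[R]_d :=
  \bigcup_(e in [set e | is_node_of i e]) cell e.

Definition neighbours (i : node T) : {set node T} :=
  [set j | `[< patch i (pos j) >]]%SET.

Definition local_max (c : node T -> R) (i : node T) : Prop :=
  forall j, j \in neighbours i -> c j <= c i.

Definition local_min (c : node T -> R) (i : node T) : Prop :=
  forall j, j \in neighbours i -> c i <= c j.

Definition local_extremum (c : node T -> R) (i : node T) : Prop :=
  local_max c i \/ local_min c i.

End mesh_geometry.

Section fe_space.
Context (R : realType) (d : nat) (Om : set 'rV[R]_d) (T : mesh R d).

(* Finite element functions live on the closure of Om; they are extended by zero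
   so that equality of functions is equality on that closure. *)
Definition fe_fun : {pred 'rV[R]_d -> R^o} := mem [set v : 'rV[R]_d -> R^o |
  [/\ {within closure Om, continuous v},
      forall x, ~ closure Om x -> v x = 0
    & forall e : elem T, exists c : vertex d (kind e) -> R,
        forall x, ref_cell (kind e) x ->
          v (elem_map e x) = \sum_a c a * shape_fun a x] ].

Lemma fe_fun_submod_closed : submod_closed fe_fun.
Proof.
split.
  rewrite inE; split=> //; first by move=> x; exact: cvg_cst.
  move=> e; exists (fun=> 0) => x _.
  by rewrite big1// => a _; rewrite mul0r.
move=> k u v; rewrite !inE => -[uc u0 ue] [vc v0 ve]; split.
- move=> x; pose F := nbhs (x : subspace (closure Om)).
  have ku : k \*: u @ F --> (k *: u x : R^o).
    by apply: (@cvgZl_tmp R R^o _ F _ k u (u x)); exact: uc.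
  exact: (@cvgD R R^o _ F _ _ _ _ _ ku (vc x)).
- by move=> x xO; rewrite [LHS]/(k * u x + v x) u0// v0// mulr0; exact: addr0.
- move=> e; have [cu cuE] := ue e; have [cv cvE] := ve e.
  exists (fun a => k * cu a + cv a) => x ex.
  have -> : (k *: u + v) (elem_map e x) =
      k * (u (elem_map e x) : R) + (v (elem_map e x) : R) by [].
  rewrite cuE// cvE// mulr_sumr -big_split/=.
  by apply: eq_bigr => a _; rewrite mulrDl mulrA.
Qed.

HB.instance Definition _ := GRing.isSubmodClosed.Build R _ fe_fun
  fe_fun_submod_closed.

Record Vh := MkVh { fe_val :> 'rV[R]_d -> R^o; fe_valP : fe_val \in fe_fun }.
HB.instance Definition _ := [isSub for fe_val].
HB.instance Definition _ := [Choice of Vh by <:].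
HB.instance Definition _ := [SubChoice_isSubLmodule of Vh by <:].

Definition nodal_basis (phi : node T -> Vh) : Prop :=
  forall i j, phi i (pos j) = (i == j)%:R.

Definition L2_inner (f v : 'rV[R]_d -> R) : R :=
  \int[@lebesgue_rV R d]_(x in Om) (f x * v x).

Definition Lp (p : \bar R) (f : 'rV[R]_d -> R) : Prop :=
  f \_ Om \in Lfun (@lebesgue_rV R d) p.

Definition ae_in (P : 'rV[R]_d -> Prop) : Prop :=
  {ae @lebesgue_rV R d, forall x, Om x -> P x}.

End fe_space.

Section scheme.
Context (R : realType) (d : nat) (Om : set 'rV[R]_d) (T : mesh R d).
Context (phi : node T -> Vh Om T).

(* A map A : Vh -> L(Vh, Vh') is encoded by the bilinear forms
   A w v z = < A(w) v, z >. *)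
Definition operator := Vh Om T -> {biscalar Vh Om T}.

Definition entry (A : operator) (w : Vh Om T) (i j : node T) : R :=
  A w (phi j) (phi i).

Definition local_entries (A : operator) : Prop :=
  forall w i j, j \notin neighbours i -> entry A w i j = 0.

Definition fe_comb (c : node T -> R) : Vh Om T := \sum_j c j *: phi j.

Definition lumped_Mmatrix_row (M K : operator) (w : Vh Om T) (i : node T) : Prop :=
  [/\ exists2 m : R, 0 < m & forall j, entry M w i j = (i == j)%:R * m,
      forall j, j != i -> entry K w i j <= 0
    & \sum_(j in neighbours i) entry K w i j = 0].

(* M(w) w' + K(w) w = f in Vh' *)
Definition balance (M K : operator) (w w' : Vh Om T) (f : 'rV[R]_d -> R) : Prop :=
  forall v : Vh Om T, M w w' v + K w w v = L2_inner Om f v.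

Definition dt (u : R -> node T -> R) (t : R) (i : node T) : R :=
  derive1 (fun s => u s i) t.

Definition semidiscrete_solution (M K : operator) (tF : R)
    (g : R -> 'rV[R]_d -> R) (u : R -> node T -> R) : Prop :=
  forall t, 0 < t < tF ->
    (forall i, derivable (fun s => u s i) t 1) /\
    balance M K (fe_comb (u t)) (fe_comb (dt u t)) (g t).

Definition time_grid (N : nat) (tF : R) (tm : nat -> R) : Prop :=
  [/\ tm 0 = 0, forall n, (n < N)%N -> tm n < tm n.+1 & tm N = tF].

(* delta_t tm u n is the difference quotient at time level n+1. *)
Definition delta_t (tm : nat -> R) (u : nat -> node T -> R) (n : nat)
    (i : node T) : R :=
  (u n.+1 i - u n i) / (tm n.+1 - tm n).

Definition discrete_solution (M K : operator) (N : nat) (tm : nat -> R)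
    (g : nat -> 'rV[R]_d -> R) (u : nat -> node T -> R) : Prop :=
  forall n, (n < N)%N ->
    balance M K (fe_comb (u n.+1)) (fe_comb (delta_t tm u n)) (g n.+1).

(* c are the nodal values and c' their (discrete) time derivatives. *)
Definition max_diminishing (c c' : node T -> R) : Prop :=
  forall i, local_max c i -> c' i <= 0.

Definition min_increasing (c c' : node T -> R) : Prop :=
  forall i, local_min c i -> 0 <= c' i.

Definition LED (c c' : node T -> R) : Prop :=
  max_diminishing c c' /\ min_increasing c c'.

End scheme.

(* Main.v *)
Require Import Defs.
From mathcomp Require Import all_boot all_order all_algebra.
From mathcomp Require Import all_classical all_reals all_analysis.
Set Implicit Arguments. Unset Strict Implicit. Unset Printing Implicit Defensive.
Import Order.TTheory GRing.Theory Num.Theory.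
Import numFieldNormedType.Exports.
Import HBNNSimple.
Local Open Scope classical_set_scope.
Local Open Scope ring_scope.

(** At an extremal node i the lumped mass matrix and the vanishing row sum turn
    the i-th equation of the scheme into
      m_i c'_i = (f, phi_i) + sum_(j in N(i)) K_ij (c_i - c_j),
    where c collects the nodal values and c' their (discrete) time derivatives
    ([lumped_balance]).  The off-diagonal K_ij are nonpositive, and the
    differences c_i - c_j all have the same sign because i is an extremum, so
    the sum pushes c_i away from the extreme value.  As phi_i >= 0, the source
    term has the sign of f ([L2_inner_le0], [L2_inner_ge0]).  This is an algebraic
    property of one equation, hence the semi-discrete problem and each backward
    Euler step are both instances of [balance_diminishing].

    The nonnegativity of phi_i comes from the elements: on each of them a finite
    element function is the combination of the shape functions weighted by its
    nodal values ([fe_val_elem]), and the shape functions are nonnegative on the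
    reference cell.  The same fact shows that a finite element function is
    nonnegative as soon as its nodal values are.

    Positivity is then an induction on the time level.  A node where u^{n+1}
    attains its global minimum is a local minimum, so the minimum has not
    decreased there during the step and is at least u^n >= 0 at that node
    ([min_increasing_ge0]).  The initial nodal values are nonnegative because
    the interpolant of u_0 is nonnegative on the open domain, hence by
    continuity on its closure, which contains the nodes. *)

(** * Integrals of functions with an almost everywhere sign *)

(** A simple function below the positive part vanishes almost everywhere, so
    the supremum that defines the integral of the positive part is zero.
    Bounding the supremum directly, rather than comparing integrals, makes the
    lemma apply to the product of the source term and a basis function without
    first showing that the product is measurable. *)
Lemma ae_le0_integral_funepos (dsp : measure_display) (X : measurableType dsp)
    (R : realType) (mu : {measure set X -> \bar R}) (D : set X)
    (f : X -> \bar R) :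
  {ae mu, forall x, D x -> (f x <= 0)%E} ->
  (\int[mu]_(x in D) f^\+ x = 0)%E.
Proof.
move=> f0; apply/eqP; rewrite eq_le; apply/andP; split; last first.
  by apply: integral_ge0 => x _; exact: funepos_ge0.
rewrite ge0_integralE; last by move=> x _; exact: funepos_ge0.
apply: ge_ereal_sup => _ [h /= hf <-].
rewrite -integralT_nnsfun.
(* h = 0 wherever f <= 0, because the positive part of f vanishes there. *)
rewrite (ae_eq_integral (cst 0%E))//; first by rewrite integral0.
- by apply/measurable_realfun.measurable_EFinP; exact: measurable_funPT.
- apply: filterS f0 => x fx0 _; apply/eqP; rewrite eq_le/= lee_fin.
  apply/andP; split; last exact: fun_ge0.
  rewrite -lee_fin; apply: (le_trans (hf x)); rewrite patchE.
  case: ifPn => // /set_mem Dx.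
  by rewrite funeposE ge_max fx0 ?lexx.
Qed.

Lemma ae_le0_integral (dsp : measure_display) (X : measurableType dsp)
    (R : realType) (mu : {measure set X -> \bar R}) (D : set X)
    (f : X -> \bar R) :
  {ae mu, forall x, D x -> (f x <= 0)%E} -> (\int[mu]_(x in D) f x <= 0)%E.
Proof.
move=> f0; rewrite integralE ae_le0_integral_funepos// sub0e oppe_le0.
by apply: integral_ge0 => x _; exact: funeneg_ge0.
Qed.

Lemma ae_ge0_integral (dsp : measure_display) (X : measurableType dsp)
    (R : realType) (mu : {measure set X -> \bar R}) (D : set X)
    (f : X -> \bar R) :
  {ae mu, forall x, D x -> (0 <= f x)%E} -> (0 <= \int[mu]_(x in D) f x)%E.
Proof.
move=> f0; rewrite integralE -(funeposN f).
rewrite (ae_le0_integral_funepos (f := (\- f)%E)) ?sube0.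
  by apply: integral_ge0 => x _; exact: funepos_ge0.
by apply: filterS f0 => x fx Dx; rewrite oppe_le0 fx.
Qed.

Lemma L2_inner_le0 (R : realType) (d : nat) (Om : set 'rV[R]_d)
    (f v : 'rV[R]_d -> R) :
  ae_in Om (fun x => f x <= 0) -> (forall x, Om x -> 0 <= v x) ->
  L2_inner Om f v <= 0.
Proof.
rewrite /ae_in => f0 v0; apply/fine_le0/ae_le0_integral.
apply: filterS f0 => x fx Ox.
by rewrite lee_fin mulr_le0_ge0 ?fx ?v0.
Qed.

Lemma L2_inner_ge0 (R : realType) (d : nat) (Om : set 'rV[R]_d)
    (f v : 'rV[R]_d -> R) :
  ae_in Om (fun x => 0 <= f x) -> (forall x, Om x -> 0 <= v x) ->
  0 <= L2_inner Om f v.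
Proof.
rewrite /ae_in => f0 v0; apply/fine_ge0/ae_ge0_integral.
apply: filterS f0 => x fx Ox.
by rewrite lee_fin mulr_ge0 ?fx ?v0.
Qed.

(** * Vertices of the reference cells *)

(** The vertex at which the shape function with the same label equals 1. *)
Definition ref_vertex (R : realType) (d : nat) (s : cell_shape) :
    vertex d s -> 'rV[R]_d :=
  match s return vertex d s -> 'rV[R]_d with
  | Simplex => fun a => \row_i (a == lift ord0 i)%:R
  | Cube => fun b => \row_i ((b : {ffun 'I_d -> bool}) i)%:R
  end.
Arguments ref_vertex {R d s} a.

Lemma sum_simplex_vertex (R : realType) (d : nat) (a : vertex d Simplex) :
  \sum_i (ref_vertex a : 'rV[R]_d) ord0 i = (a != ord0)%:R.
Proof.
under eq_bigr do rewrite mxE.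
case: (unliftP ord0 a) => [k ->|->]; last first.
  by rewrite eqxx big1 // => i _; rewrite (negbTE (neq_lift _ _)).
rewrite (bigD1 k)//= eqxx big1 ?addr0//.
by move=> i ik; rewrite (inj_eq (@lift_inj _ _)) eq_sym (negbTE ik).
Qed.

Lemma ref_vertex_in_cell (R : realType) (d : nat) (s : cell_shape)
    (a : vertex d s) : ref_cell s (ref_vertex a : 'rV[R]_d).
Proof.
case: s a => a /=.
  split=> [i|]; first by rewrite mxE ler0n.
  by rewrite sum_simplex_vertex; case: (_ != _).
by move=> i; rewrite mxE; case: (a i); rewrite ?lexx ler01.
Qed.

(** The Lagrange property: it identifies the coefficients of a function in the
    shape functions with its values at the vertices. *)
Lemma shape_fun_ref_vertex (R : realType) (d : nat) (s : cell_shape)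
    (a b : vertex d s) : shape_fun b (ref_vertex a : 'rV[R]_d) = (b == a)%:R.
Proof.
case: s a b => a b.
  rewrite [shape_fun _ _]/= -/(ref_vertex (a : vertex d Simplex)).
  rewrite sum_simplex_vertex.
  case: (unliftP ord0 b) => [k ->|->]; first by rewrite mxE eq_sym.
  by rewrite [_ == a]eq_sym; case: (a == _) => /=; rewrite ?subr0 ?subrr.
rewrite /=; under eq_bigr do rewrite mxE.
have [<-|ba] := eqVneq b a.
  by rewrite big1 // => i _; case: (b i); rewrite ?subr0.
(* A coordinate in which the vertices differ gives a zero factor. *)
have [i abi] : exists i, b i != a i.
  apply/existsP; apply: contraNT ba; rewrite negb_exists => /forallP h.
  by apply/eqP/ffunP => i; apply/eqP; have := h i; rewrite negbK.
rewrite (bigD1 i)//=; move: abi; case: (b i); case: (a i) => //= _.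
  by rewrite mul0r.
by rewrite subrr mul0r.
Qed.

Lemma shape_fun_ge0 (R : realType) (d : nat) (s : cell_shape)
    (a : vertex d s) (x : 'rV[R]_d) : ref_cell s x -> 0 <= shape_fun a x.
Proof.
case: s a => a /= => [[x0 x1]|x01].
  by case: (unlift ord0 a) => [i|]; rewrite ?subr_ge0.
apply: prodr_ge0 => i _; have /andP[x0 x1] := x01 i.
by case: (a i); rewrite ?subr_ge0.
Qed.

Lemma elem_map_ref_vertex (R : realType) (d : nat) (T : mesh R d) (e : elem T)
    (a : vertex d (kind e)) : elem_map e (ref_vertex a) = pos (vert e a).
Proof.
rewrite /elem_map (bigD1 a)//= shape_fun_ref_vertex eqxx scale1r big1 ?addr0//.
by move=> b ba; rewrite shape_fun_ref_vertex (negbTE ba) scale0r.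
Qed.

(** * Sign of finite element functions *)

(** The coefficients of v on e are only known to exist; evaluating at the
    vertices of the reference cell shows that they are the nodal values. *)
Lemma fe_val_elem (R : realType) (d : nat) (Om : set 'rV[R]_d) (T : mesh R d)
    (v : Vh Om T) (e : elem T) (x : 'rV[R]_d) : ref_cell (kind e) x ->
  v (elem_map e x) = \sum_a v (pos (vert e a)) * shape_fun a x.
Proof.
move=> ex; have := fe_valP v; rewrite inE => -[_ _ /(_ e)[c cE]].
rewrite cE//; apply: eq_bigr => a _; congr (_ * _).
rewrite -elem_map_ref_vertex cE; last exact: ref_vertex_in_cell.
rewrite (bigD1 a)//= shape_fun_ref_vertex eqxx mulr1 big1 ?addr0//.
by move=> b ba; rewrite shape_fun_ref_vertex (negbTE ba) mulr0.
Qed.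

(** A discrete maximum principle for interpolation: on each element v is a
    combination of nonnegative shape functions with its nodal values as
    weights. *)
Lemma fe_val_ge0 (R : realType) (d : nat) (Om : set 'rV[R]_d) (T : mesh R d)
    (v : Vh Om T) : conforming T Om -> (forall i : node T, 0 <= v (pos i)) ->
  forall x, Om x -> 0 <= v x.
Proof.
move=> [_ _ _ clE _] v0 x /subset_closure; rewrite clE => -[e _ [y ye <-]].
rewrite fe_val_elem//; apply: sumr_ge0 => a _.
by rewrite mulr_ge0 ?shape_fun_ge0.
Qed.

Lemma closure_pos (R : realType) (d : nat) (Om : set 'rV[R]_d) (T : mesh R d)
    (i : node T) : conforming T Om -> closure Om (pos i).
Proof.
move=> [_ /(_ i)[e [a <-]] _ -> _]; exists e => //; exists (ref_vertex a).
  exact: ref_vertex_in_cell.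
exact: elem_map_ref_vertex.
Qed.

(** Nodes may lie on the boundary, where positivity has to be inherited from
    the open domain by continuity. *)
Lemma fe_val_closure_ge0 (R : realType) (d : nat) (Om : set 'rV[R]_d)
    (T : mesh R d) (v : Vh Om T) : (forall x, Om x -> 0 <= v x) ->
  forall x, closure Om x -> 0 <= v x.
Proof.
move=> v0 x clx; rewrite leNgt; apply/negP => vx0.
have := fe_valP v; rewrite inE => -[/(_ x) vc _ _].
have : within (closure Om) (nbhs x) [set y | v y < 0].
  by rewrite nbhs_subspace_in//; exact: (vc _ (lt_nbhsl vx0)).
move=> /clx[y [Oy vy]].
by have /= := vy (subset_closure Oy); rewrite ltNge v0.
Qed.

Lemma fe_combE (R : realType) (d : nat) (Om : set 'rV[R]_d) (T : mesh R d)
    (phi : node T -> Vh Om T) (c : node T -> R) (x : 'rV[R]_d) :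
  fe_comb phi c x = \sum_j c j * phi j x.
Proof.
rewrite /fe_comb.
by elim/big_rec2: _ => [//|j y v _ <-].
Qed.

Lemma fe_comb_pos (R : realType) (d : nat) (Om : set 'rV[R]_d) (T : mesh R d)
    (phi : node T -> Vh Om T) (c : node T -> R) (i : node T) :
  nodal_basis phi -> fe_comb phi c (pos i) = c i.
Proof.
move=> hphi; rewrite fe_combE (bigD1 i)//= hphi eqxx mulr1 big1 ?addr0//.
by move=> j ji; rewrite hphi (negbTE ji) mulr0.
Qed.

Lemma nodal_basis_ge0 (R : realType) (d : nat) (Om : set 'rV[R]_d)
    (T : mesh R d) (phi : node T -> Vh Om T) (i : node T) :
  conforming T Om -> nodal_basis phi -> forall x, Om x -> 0 <= phi i x.
Proof. by move=> hT hphi; apply: fe_val_ge0 => // j; rewrite hphi ler0n. Qed.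

(** * Rows of the scheme at local extrema *)

Lemma balance_row (R : realType) (d : nat) (Om : set 'rV[R]_d) (T : mesh R d)
    (phi : node T -> Vh Om T) (M K : operator Om T) (c c' : node T -> R)
    (f : 'rV[R]_d -> R) (i : node T) :
  balance M K (fe_comb phi c) (fe_comb phi c') f ->
  \sum_j c' j * entry phi M (fe_comb phi c) i j +
  \sum_j c j * entry phi K (fe_comb phi c) i j = L2_inner Om f (phi i).
Proof.
move/(_ (phi i)) <-.
rewrite {4 6}/fe_comb !linear_sumlz.
by congr (_ + _); apply: eq_bigr => j _; rewrite linearZl_LR.
Qed.

(** Since the i-th row of K sums to zero, c i may be subtracted from every nodal
    value; this replaces c j by differences whose sign is known at an
    extremum. *)
Lemma lumped_balance (R : realType) (d : nat) (Om : set 'rV[R]_d)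
    (T : mesh R d) (phi : node T -> Vh Om T) (M K : operator Om T)
    (c c' : node T -> R) (f : 'rV[R]_d -> R) (i : node T) :
  local_entries phi K -> balance M K (fe_comb phi c) (fe_comb phi c') f ->
  lumped_Mmatrix_row phi M K (fe_comb phi c) i ->
  exists2 m, 0 < m & m * c' i = L2_inner Om f (phi i) +
    \sum_(j in neighbours i) entry phi K (fe_comb phi c) i j * (c i - c j).
Proof.
move=> hK /(@balance_row _ _ _ _ _ _ _ _ _ _ i) bal [[m m0 Mm] _ K0].
exists m => //; rewrite -bal.
under [X in _ = _ + X]eq_bigr do rewrite mulrBr.
rewrite sumrB -mulr_suml K0 mul0r sub0r.
rewrite (bigD1 i)//= Mm eqxx mul1r big1 ?addr0; last first.
  by move=> j ji; rewrite Mm eq_sym (negbTE ji) mul0r mulr0.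
rewrite [X in _ + X - _](bigID (mem (neighbours i)))/=.
rewrite [X in _ + (_ + X) - _]big1 ?addr0; last first.
  by move=> j ji; rewrite hK ?mulr0.
rewrite [X in _ + X - _](eq_bigr _ (fun j _ => mulrC _ _)).
by rewrite addrK mulrC.
Qed.

Lemma balance_local_max (R : realType) (d : nat) (Om : set 'rV[R]_d)
    (T : mesh R d) (phi : node T -> Vh Om T) (M K : operator Om T)
    (c c' : node T -> R) (f : 'rV[R]_d -> R) (i : node T) :
  conforming T Om -> nodal_basis phi -> local_entries phi K ->
  balance M K (fe_comb phi c) (fe_comb phi c') f ->
  ae_in Om (fun x => f x <= 0) ->
  lumped_Mmatrix_row phi M K (fe_comb phi c) i ->
  local_max c i -> c' i <= 0.
Proof.
move=> hT hphi hK bal f0 row ci; have [m m0 mE] := lumped_balance hK bal row.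
rewrite -(pmulr_rle0 _ m0) mE; case: row => _ Kle _.
rewrite -[leRHS]addr0; apply: lerD.
  exact: (L2_inner_le0 f0 (nodal_basis_ge0 i hT hphi)).
apply: sumr_le0 => j nj; have [->|ji] := eqVneq j i.
  by rewrite subrr mulr0.
by rewrite mulr_le0_ge0 ?Kle// subr_ge0 ci.
Qed.

Lemma balance_local_min (R : realType) (d : nat) (Om : set 'rV[R]_d)
    (T : mesh R d) (phi : node T -> Vh Om T) (M K : operator Om T)
    (c c' : node T -> R) (f : 'rV[R]_d -> R) (i : node T) :
  conforming T Om -> nodal_basis phi -> local_entries phi K ->
  balance M K (fe_comb phi c) (fe_comb phi c') f ->
  ae_in Om (fun x => 0 <= f x) ->
  lumped_Mmatrix_row phi M K (fe_comb phi c) i ->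
  local_min c i -> 0 <= c' i.
Proof.
move=> hT hphi hK bal f0 row ci; have [m m0 mE] := lumped_balance hK bal row.
rewrite -(pmulr_rge0 _ m0) mE; case: row => _ Kle _.
apply: addr_ge0; first exact: (L2_inner_ge0 f0 (nodal_basis_ge0 i hT hphi)).
apply: sumr_ge0 => j nj; have [->|ji] := eqVneq j i.
  by rewrite subrr mulr0.
by rewrite mulr_le0 ?Kle// subr_le0 ci.
Qed.

(** The nodal values c and the vector c' enter only through one balance
    equation, so that c' may be a time derivative or a difference quotient. *)
Lemma balance_diminishing (R : realType) (d : nat) (Om : set 'rV[R]_d)
    (T : mesh R d) (phi : node T -> Vh Om T) (M K : operator Om T)
    (c c' : node T -> R) (f : 'rV[R]_d -> R) :
  conforming T Om -> nodal_basis phi -> local_entries phi K ->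
  balance M K (fe_comb phi c) (fe_comb phi c') f ->
  let row i := lumped_Mmatrix_row phi M K (fe_comb phi c) i in
  [/\ ae_in Om (fun x => f x = 0) ->
      (forall i, local_extremum c i -> row i) -> LED c c',
      ae_in Om (fun x => f x <= 0) ->
      (forall i, local_max c i -> row i) -> max_diminishing c c'
    & ae_in Om (fun x => 0 <= f x) ->
      (forall i, local_min c i -> row i) -> min_increasing c c'].
Proof.
move=> hT hphi hK bal row.
have dmax : ae_in Om (fun x => f x <= 0) ->
    (forall i, local_max c i -> row i) -> max_diminishing c c'.
  move=> f0 hrow i ci.
  exact: (balance_local_max hT hphi hK bal f0 (hrow i ci) ci).
have imin : ae_in Om (fun x => 0 <= f x) ->
    (forall i, local_min c i -> row i) -> min_increasing c c'.
  move=> f0 hrow i ci.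
  exact: (balance_local_min hT hphi hK bal f0 (hrow i ci) ci).
split=> // f0 hrow; split.
- apply: dmax => [|i ci]; last by apply: hrow; left.
  by move: f0; rewrite /ae_in; apply: filterS => x fx Ox; rewrite fx.
- apply: imin => [|i ci]; last by apply: hrow; right.
  by move: f0; rewrite /ae_in; apply: filterS => x fx Ox; rewrite fx.
Qed.

(** * Positivity *)

(** It suffices to look at a global minimum of the new values, which is a local
    minimum: there the new value is at least the old one. *)
Lemma min_increasing_ge0 (R : realType) (d : nat) (T : mesh R d)
    (tm : nat -> R) (u : nat -> node T -> R) (n : nat) :
  tm n < tm n.+1 -> min_increasing (u n.+1) (delta_t tm u n) ->
  (forall i, 0 <= u n i) -> forall i, 0 <= u n.+1 i.
Proof.
move=> dt0 hmin un0 i.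
case: (@arg_minP _ _ _ i xpredT (u n.+1) isT) => k _ kmin.
apply: le_trans (kmin i isT); apply: le_trans (un0 k) _.
have /hmin : local_min (u n.+1) k by move=> j _; exact: kmin.
by rewrite /delta_t pmulr_lge0 ?subr_ge0// invr_gt0 subr_gt0.
Qed.

Theorem theorem4p1 (R : realType) (d : nat) (hd : (d = 2)%N \/ (d = 3)%N)
    (Om : set 'rV[R]_d) (hOm : domain Om)
    (T : mesh R d) (hT : conforming T Om)
    (phi : node T -> Vh Om T) (hphi : nodal_basis phi)
    (M K : operator Om T) (hM : local_entries phi M) (hK : local_entries phi K)
    (tF : R) (htF : 0 < tF) :
  (* semi-discrete problem *)
  (forall (g : R -> 'rV[R]_d -> R) (u : R -> node T -> R),
    (forall t, 0 < t < tF -> Lp Om 2%:E (g t)) ->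
    semidiscrete_solution phi M K tF g u ->
    forall t, 0 < t < tF ->
    let row i := lumped_Mmatrix_row phi M K (fe_comb phi (u t)) i in
    [/\ ae_in Om (fun x => g t x = 0) ->
        (forall i, local_extremum (u t) i -> row i) ->
        LED (u t) (dt u t),
        ae_in Om (fun x => g t x <= 0) ->
        (forall i, local_max (u t) i -> row i) ->
        max_diminishing (u t) (dt u t)
      & ae_in Om (fun x => 0 <= g t x) ->
        (forall i, local_min (u t) i -> row i) ->
        min_increasing (u t) (dt u t)])
  /\
  (* backward Euler *)
  (forall (N : nat) (tm : nat -> R) (g : nat -> 'rV[R]_d -> R)
      (u : nat -> node T -> R),
    time_grid N tF tm ->
    (forall n, (n < N)%N -> Lp Om 2%:E (g n.+1)) ->
    discrete_solution phi M K N tm g u ->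
    let row n i := lumped_Mmatrix_row phi M K (fe_comb phi (u n)) i in
    (forall n, (n < N)%N ->
      [/\ ae_in Om (fun x => g n.+1 x = 0) ->
          (forall i, local_extremum (u n.+1) i -> row n.+1 i) ->
          LED (u n.+1) (delta_t tm u n),
          ae_in Om (fun x => g n.+1 x <= 0) ->
          (forall i, local_max (u n.+1) i -> row n.+1 i) ->
          max_diminishing (u n.+1) (delta_t tm u n)
        & ae_in Om (fun x => 0 <= g n.+1 x) ->
          (forall i, local_min (u n.+1) i -> row n.+1 i) ->
          min_increasing (u n.+1) (delta_t tm u n)])
    /\
    (forall (u0 : 'rV[R]_d -> R) (pi_h : ('rV[R]_d -> R) -> Vh Om T),
      Lp Om +oo%E u0 ->
      fe_comb phi (u 0%N) = pi_h u0 ->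
      (* the interpolation keeps the sign of u0 *)
      (ae_in Om (fun x => 0 <= u0 x) -> forall x, Om x -> 0 <= pi_h u0 x) ->
      (forall n, (n < N)%N -> ae_in Om (fun x => g n.+1 x = 0)) ->
      (forall n i, (n < N)%N -> local_extremum (u n.+1) i -> row n.+1 i) ->
      ae_in Om (fun x => 0 <= u0 x) ->
      forall n, (n <= N)%N -> forall x, Om x -> 0 <= fe_comb phi (u n) x)).
Proof.
split=> [g u _ sol t t01 row|N tm g u [_ tm_lt _] _ sol row].
  by have [_ bal] := sol t t01; exact: balance_diminishing hT hphi hK bal.
have step n (nN : (n < N)%N) := balance_diminishing hT hphi hK (sol n nN).
split=> // u0 pi_h _ u0E pi_h_ge0 g0 hrow u0_ge0 n nN.
suff un0 : forall i, 0 <= u n i.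
  by apply: fe_val_ge0 => // i; rewrite fe_comb_pos.
elim: n nN => [_ i|n IHn nN].
  rewrite -(fe_comb_pos (u 0%N) i hphi) u0E.
  have clo_ge0 := fe_val_closure_ge0 (pi_h_ge0 u0_ge0).
  exact/clo_ge0/closure_pos.
have [led _ _] := step n nN; have [|_ hmin] := led (g0 n nN).
  by move=> i; exact: hrow.
exact: (min_increasing_ge0 (tm_lt n nN) hmin (IHn (ltnW nN))).
Qed.
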